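(* Let $q$ be a prime power, $h$ a positive integer, and let $C$ be a faithful additive QMDS $[n,r/h,d]_q^h$ code with $r=h+r_0$ and $1\le r_0<h$. Then the dual code $C^\perp$ is an additive $[n,n-r/h,d^\perp]_q^h$ code that is QMDS.
   Context: An additive $[n,r/h,d]_q^h$ code is an $\mathbb{F}_q$-linear subspace $C\subseteq\mathbb{F}_{q^h}^n$ with $\dim_{\mathbb{F}_q}C=r$ and minimum Hamming distance $d=\min\{\mathrm{wt}(c):c\in C\setminus\{0\}\}$, where $\mathrm{wt}(c)$ is the number of nonzero coordinates of $c$. It is called QMDS (quasi-MDS) if $d=n-\lceil r/h\rceil+1$. The dual is $C^\perp=\{v\in\mathbb{F}_{q^h}^n:\mathrm{Tr}_{q^h/q}(\langle u,v\rangle)=0\text{ for all }u\in C\}$, where $\langle u,v\rangle=\sum_i u_iv_i$; $d^\perp$ denotes its minimum distance. Let $G$ be an $r\times n$ matrix over $\mathbb{F}_{q^h}$ whose rows form an $\mathbb{F}_q$-basis of $C$ (a generator matrix). Fix an $\mathbb{F}_q$-basis of $\mathbb{F}_{q^h}$ and expand each entry of $G$ in this basis, so that the $j$-th column of $G$ becomes a block of $h$ columns in $\mathbb{F}_q^r$. Let $U_j\subseteq\mathbb{F}_q^r$ be the $\mathbb{F}_q$-span of the $j$-th block and $W_j:=U_j^\perp$ its orthogonal complement with respect to the standard scalar product of $\mathbb{F}_q^r$. The code $C$ is faithful if $\dim_{\mathbb{F}_q} W_j=r-h$ for all $j=1,\dots,n$ (this does not depend on the choices made). *)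

(* Defs.v *)
From HB Require Import structures.
From mathcomp Require Import all_boot all_order all_algebra all_field.

Set Implicit Arguments.
Unset Strict Implicit.
Unset Printing Implicit Defensive.

Import Order.TTheory GRing.Theory Num.Theory.
Local Open Scope ring_scope.

Section DotProduct.
Variables (K : fieldType) (m : nat).

Definition dotp (u v : 'cV[K]_m) : K := \sum_i u i 0 * v i 0.

Fact dotp_bilinear :
  bilinear_for (GRing.Scale.Law.clone _ _ *%R _)
               (GRing.Scale.Law.clone _ _ (idfun \; *%R) _) dotp.
Proof.
split=> u a v w; rewrite /dotp /= mulr_sumr -big_split /=;
  by apply: eq_bigr => i _; rewrite !mxE ?mulrDl ?mulrDr ?mulrA // (mulrC a).
Qed.

HB.instance Definition _ := bilinear_isBilinear.Build K _ _ _ _ _ dotp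
  dotp_bilinear.

Fact dotp_sym u v : dotp u v = (-1) ^+ false * idfun (dotp v u).
Proof. by rewrite mul1r; apply: eq_bigr => i _; rewrite mulrC. Qed.

HB.instance Definition _ := isHermitianSesquilinear.Build K _ _ _ dotp dotp_sym.

End DotProduct.

Section Codes.
(* F is the field with q elements and L the field with q ^ h elements, where
   h = \dim {:L}.  Every finite extension of a finite field is a splitting
   field, so taking L : splittingFieldType F is no restriction; it gives access
   to galTrace. *)
Variables (F : finFieldType) (L : splittingFieldType F) (n : nat).

Definition fTr (x : L) : F :=
  coord [tuple (1 : L)] ord0 (galTrace 1 {:L} x).

Lemma fTrE (x : L) : (fTr x)%:A = galTrace 1 {:L} x.
Proof.
have Tx : galTrace 1 {:L} x \in <<[tuple 1%R : L]>>%VS.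
  by rewrite span_seq1; apply: mem_galTrace (memvf x); apply: finField_galois (sub1v _).
by rewrite [RHS](coord_span Tx) big_ord1.
Qed.

Fact fTr_linear : linear_for *%R fTr.
Proof.
move=> a x y; rewrite /fTr -linearP /=; congr (coord _ _ _).
rewrite /galTrace scaler_sumr -big_split /=.
by apply: eq_bigr => s _; rewrite linearP.
Qed.

HB.instance Definition _ := GRing.isLinear.Build F L F *%R fTr fTr_linear.

Implicit Types (u v : {ffun 'I_n -> L}) (C : {vspace {ffun 'I_n -> L}}).

Definition trform u v : F := fTr (\sum_i u i * v i).

Fact trform_bilinear :
  bilinear_for (GRing.Scale.Law.clone _ _ *%R _)
               (GRing.Scale.Law.clone _ _ (idfun \; *%R) _) trform.
Proof.
split=> u a v w; rewrite /trform /= -linearP scaler_sumr -big_split /=;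
  congr fTr; apply: eq_bigr => i _; rewrite !ffunE.
  by rewrite mulrDl scalerAl.
by rewrite mulrDr scalerAr.
Qed.

HB.instance Definition _ := bilinear_isBilinear.Build F _ _ _ _ _ trform
  trform_bilinear.

Fact trform_sym u v : trform u v = (-1) ^+ false * idfun (trform v u).
Proof. by rewrite mul1r; congr fTr; apply: eq_bigr => i _; rewrite mulrC. Qed.

HB.instance Definition _ :=
  isHermitianSesquilinear.Build F _ _ _ trform trform_sym.

Definition dual_code C : {vspace {ffun 'I_n -> L}} := orthov trform C.

Lemma dual_codeP C v :
  reflect (forall u, u \in C -> galTrace 1 {:L} (\sum_i u i * v i) = 0)
          (v \in dual_code C).
Proof.
apply: (iffP mem_orthovP) => vC u uC.
  by rewrite -fTrE -/(trform u v) trform_sym mul1r /= vC // scale0r.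
apply/eqP; have := vC u uC; rewrite -fTrE => /eqP.
by rewrite scaler_eq0 oner_eq0 orbF -/(trform u v) trform_sym mul1r.
Qed.

Definition wt u : nat := #|[set i | u i != 0]|.

(* The zero code has no minimum distance. *)
Definition min_distance C (d : nat) : Prop :=
  (exists2 c, (c \in C) && (c != 0) & wt c = d) /\
  (forall c, c \in C -> c != 0 -> (d <= wt c)%N).

(* C is an additive [n, r/h, d]_q^h code. *)
Definition additive_code C (r h d : nat) : Prop :=
  [/\ \dim {:L} = h, \dim C = r & min_distance C d].

Definition additive_qmds_code C (r h d : nat) : Prop :=
  additive_code C r h d /\
  d%:Z = n%:Z - Num.ceil (r%:R / h%:R : rat) + 1.

Definition generator_matrix C (r : nat) (G : 'M[L]_(r, n)) : Prop :=
  basis_of C [seq [ffun j => G i j] | i : 'I_r].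

(* The block of h columns obtained by expanding the j-th column of G in e. *)
Definition column_block (r h : nat) (e : h.-tuple L) (G : 'M[L]_(r, n))
    (j : 'I_n) : 'M[F]_(r, h) :=
  \matrix_(i, k) coord e k (G i j).

Definition U_ (r h : nat) (e : h.-tuple L) (G : 'M[L]_(r, n)) (j : 'I_n) :
    {vspace 'cV[F]_r} :=
  <<[seq col k (column_block e G j) | k : 'I_h]>>%VS.

Definition W_ (r h : nat) (e : h.-tuple L) (G : 'M[L]_(r, n)) (j : 'I_n) :
    {vspace 'cV[F]_r} :=
  orthov (@dotp F r) (U_ e G j).

(* The condition on the spaces W_j does not depend on G and e.  It is written
   \dim W_j + h = r rather than \dim W_j = r - h to avoid truncated
   subtraction. *)
Definition faithful_code C : Prop :=
  exists (G : 'M[L]_(\dim C, n)) (e : (\dim {:L}).-tuple L),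
    [/\ generator_matrix C G, basis_of {:L} e
      & forall j, (\dim (W_ e G j) + \dim {:L} = \dim C)%N].

End Codes.

(* Main.v *)
(* Since 1 < r/h < 2, the dual is QMDS exactly when its minimum distance is 2.
   Faithfulness says that every coordinate projection C -> L is onto, so by
   nondegeneracy of the trace form no dual word has weight 1; and two
   coordinates span a space of dimension 2h > r, in which the r = dim C
   orthogonality conditions leave a nonzero dual word of weight at most 2. *)

From HB Require Import structures.
Require Import Defs.
From mathcomp Require Import all_boot all_order all_algebra all_fingroup all_field.


Set Implicit Arguments.
Unset Strict Implicit.
Unset Printing Implicit Defensive.

Import Order.TTheory GRing.Theory Num.Theory.
Local Open Scope ring_scope.

(** Each [f i] takes values in a line, so passing to its kernel lowers the dimension by at most
    one. *)
Lemma leq_dim_bigcap_lker (K : fieldType) (vT : vectType K) m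
    (f : 'I_m -> 'Hom(vT, K^o)) (U : {vspace vT}) :
  (\dim U <= \dim (U :&: \bigcap_(i < m) lker (f i)) + m)%N.
Proof.
elim: m f => [|m IHm] f; first by rewrite big_ord0 capvf addn0.
rewrite big_ord_recr capvA /=.
set V := (U :&: \bigcap_(i < m) _)%VS.
have leV : (\dim V <= \dim (V :&: lker (f ord_max)) + 1)%N.
  rewrite -{1}(limg_ker_dim (f ord_max) V) leq_add2l.
  by apply: leq_trans (dimvS (subvf _)) _; rewrite dimvf.
apply: leq_trans (IHm (fun i => f (widen_ord (leqnSn m) i))) _.
by rewrite -/V addnS -addSn leq_add2r -addn1.
Qed.

Section Orthogonal.
Variables (K : fieldType) (eps : bool) (theta : {rmorphism K -> K}).
Variables (vT : vectType K) (form : {hermitian vT for eps & theta}).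
Implicit Types U V : {vspace vT}.

Lemma leq_dim_orthov U V : (\dim U <= \dim (U :&: orthov form V) + \dim V)%N.
(* [orthov form V] unfolds to an intersection of [\dim V] kernels, one for each vector of a basis of
   [V]. *)
Proof. exact: leq_dim_bigcap_lker. Qed.

Lemma dim_orthov V :
  nondegenerate form -> (\dim V + \dim (orthov form V) = \dim {:vT})%N.
Proof.
move=> /eqP rad0; apply/eqP; rewrite eqn_leq; apply/andP; split; last first.
  by have := leq_dim_orthov fullv V; rewrite capfv addnC.
set P := orthov form V.
(* By symmetry [V] is orthogonal to [P], so a vector of [V] orthogonal to [P^C] as well is
   orthogonal to the whole space and lies in the radical, which is zero. The [\dim P^C] conditions
   then bound [\dim V]. *)
suff VP0 : (V :&: orthov form P^C = 0)%VS.
  have := leq_dim_orthov V P^C; rewrite VP0 dimv0 add0n dimv_compl.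
  by rewrite leq_subRL ?dimvS ?subvf // addnC.
apply/eqP; rewrite -subv0 -rad0 -(addv_complf P) orthovD capvSr andbT.
by rewrite (subv_trans (capvSl _ _)) // orthov_sym.
Qed.

End Orthogonal.

Section Dual.
Variables (F : finFieldType) (L : splittingFieldType F) (n : nat).
Implicit Types (C : {vspace {ffun 'I_n -> L}}).

Lemma fTr_neq0 : exists x : L, fTr x != 0.
Proof.
(* The trace is the sum of all Galois automorphisms, a combination with coefficients 1, hence
   nonzero by their linear independence. *)
have [x _] := @gal_independent_contra _ _ {:L} [in 'Gal({:L} / 1)%g] (fun=> 1) _
  (group1 _) (oner_neq0 _).
under eq_bigr do rewrite mul1r.
rewrite -/(galTrace 1 {:L} x) -fTrE => nz; exists x.
by apply: contraNneq nz => ->; rewrite scale0r.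
Qed.

Lemma fTr_mul_eq0 (a : L) : (forall x, fTr (x * a) = 0) -> a = 0.
Proof.
move=> a0; apply/eqP/negPn/negP => nz_a; have [x /eqP] := fTr_neq0.
by case; rewrite -(a0 (x / a)) divfK.
Qed.

Definition delta_word (j : 'I_n) (a : L) : {ffun 'I_n -> L} :=
  [ffun i => if i == j then a else 0].

Lemma sum_delta_word j a (v : {ffun 'I_n -> L}) :
  \sum_i delta_word j a i * v i = a * v j.
Proof.
rewrite (bigD1 j) //= ffunE eqxx big1 ?addr0 // => i /negPf nij.
by rewrite ffunE nij mul0r.
Qed.

Lemma trform_nondegenerate : nondegenerate (@trform F L n).
Proof.
rewrite /nondegenerate -subv0; apply/subvP => v /mem_orthovP v0.
rewrite memv0; apply/eqP/ffunP => j; rewrite [RHS]ffunE.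
apply: fTr_mul_eq0 => x; rewrite -sum_delta_word -/(trform _ _).
by rewrite trform_sym mul1r /= v0 // memvf.
Qed.

Lemma dim_dual_code C : (\dim (dual_code C) = n * \dim {:L} - \dim C)%N.
Proof.
have := dim_orthov C trform_nondegenerate; rewrite -/(dual_code C).
rewrite [in RHS]dimvf /dim /= card_ord -/(dim L) -dimvf => <-.
by rewrite addKn.
Qed.

Lemma faithful_coord_eq0 C j (a : L) :
  faithful_code C -> (forall u, u \in C -> fTr (u j * a) = 0) -> a = 0.
Proof.
case=> G [e [Gbasis ebasis Wdim]] Ca0.
set h := \dim {:L} in e ebasis Wdim.
pose X := [tuple col k (column_block e G j) | k < h].
(* [X] spans [U_ e G j], whose dimension is at least [\dim C - \dim (W_ e G j) = h], the number of
   vectors in [X]. *)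
have Xfree : free X.
  rewrite /free eqn_leq dim_span size_tuple /=.
  have := leq_dim_orthov (@dotp F (\dim C)) fullv (U_ e G j).
  rewrite capfv -/(W_ e G j) dimvf /dim /= muln1 => leC.
  rewrite -(leq_add2l (\dim (W_ e G j))) Wdim; apply: leq_trans leC _.
  by rewrite /U_ /image_mem.
have phi0 : forall k : 'I_h, fTr (e`_k * a) = 0.
  (* Entry [i] of the relation is [fTr (G i j * a)] with [G i j] expanded in [e]; it vanishes
     because row [i] of [G] is a codeword. *)
  apply: (freeP Xfree (fun k => fTr (e`_k * a))).
  apply/colP => i; rewrite summxE mxE.
  have uC : [ffun j => G i j] \in C.
    by apply: (basis_mem Gbasis); apply: image_f.
  rewrite -[RHS](Ca0 _ uC) ffunE.
  rewrite [in RHS](coord_basis ebasis (memvf (G i j))) mulr_suml linear_sum /=.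
  apply: eq_bigr => k _.
  by rewrite nth_mktuple !mxE -scalerAl linearZ /= mulrC.
apply: fTr_mul_eq0 => x.
rewrite (coord_basis ebasis (memvf x)) mulr_suml linear_sum big1 // => k _.
by rewrite -scalerAl linearZ /= phi0 mulr0.
Qed.

Lemma wt_gt0 (u : {ffun 'I_n -> L}) : u != 0 -> (0 < wt u)%N.
Proof.
apply: contraNltn; rewrite leqn0 cards_eq0 => /eqP u0.
apply/eqP/ffunP => i; rewrite [RHS]ffunE.
by apply/eqP/negPn; have := in_set0 i; rewrite -u0 inE => ->.
Qed.

(** If the support of [v] were a single [j], orthogonality to [C] would reduce to
    [fTr (u j * v j) = 0] for all codewords [u], forcing [v j = 0]. *)
Lemma faithful_dual_wt C (v : {ffun 'I_n -> L}) :
  faithful_code C -> v \in dual_code C -> v != 0 -> (1 < wt v)%N.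
Proof.
move=> faithC /mem_orthovP vC nz_v.
rewrite ltn_neqAle wt_gt0 // andbT eq_sym.
apply/negP => /cards1P [j vj].
have vE i : (v i != 0) = (i == j) by have /setP/(_ i) := vj; rewrite !inE.
have := vE j; rewrite eqxx => /negP; apply; apply/eqP.
apply: (faithful_coord_eq0 (j := j) faithC) => u uC.
rewrite -[RHS](vC u uC) -[RHS]/(trform v u) trform_sym mul1r /= /trform (bigD1 j) //=.
rewrite [\sum_(i < n | _) _]big1 ?addr0 // => i; rewrite -vE negbK => /eqP ->.
by rewrite mulr0.
Qed.

(** Parametrises the words supported on two distinct coordinates by [L * L], so that they form the
    image of an injective linear map. *)
Definition two_words (i j : 'I_n) (p : L * L) : {ffun 'I_n -> L} :=
  delta_word i p.1 + delta_word j p.2.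

Fact two_words_linear i j : linear (two_words i j).
Proof.
move=> a p p'; apply/ffunP => k; rewrite !ffunE.
by do 2!case: eqP => _; rewrite ?scalerDr ?scaler0 ?addr0 ?add0r // addrACA.
Qed.

HB.instance Definition _ i j := GRing.isLinear.Build F (L * L)%type
  {ffun 'I_n -> L} *:%R (two_words i j) (two_words_linear i j).

Lemma dual_wt_le2 C (i j : 'I_n) : i != j -> (\dim C < 2 * \dim {:L})%N ->
  exists v, [/\ v \in dual_code C, v != 0 & (wt v <= 2)%N].
Proof.
move=> nij ltC; pose f := linfun (two_words i j).
have f_inj : lker f == 0%VS.
  apply/lker0P => p p'; rewrite !lfunE /= => /ffunP eq_pp'.
  have := eq_pp' i; have := eq_pp' j; rewrite !ffunE !eqxx (negPf nij) eq_sym.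
  by rewrite (negPf nij) !addr0 !add0r; case: p p' {eq_pp'} => [? ?] [? ?] /= -> ->.
have dimf : \dim (limg f) = (2 * \dim {:L})%N.
  rewrite limg_dim_eq; last by rewrite (eqP f_inj) capv0.
  by rewrite !dimvf /dim /= mul2n -addnn.
have := leq_dim_orthov (@trform F L n) (limg f) C; rewrite dimf => leD.
(* The [\dim C] orthogonality conditions are fewer than the dimension of [limg f]. *)
have nz : (limg f :&: dual_code C)%VS != 0%VS.
  rewrite -dimv_eq0 -lt0n -(ltn_add2r (\dim C)) add0n.
  exact: leq_trans ltC leD.
exists (vpick (limg f :&: dual_code C)); rewrite vpick0 nz.
have /memv_capP [/memv_imgP [p _ ->] ->] := memv_pick (limg f :&: dual_code C).
split=> //; apply: (@leq_trans #|[set i; j]|); last first.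
  by rewrite cards2; case: (i == j).
apply/subset_leq_card/subsetP => k; rewrite !inE lfunE /= !ffunE.
by apply: contraR => /norP [/negPf-> /negPf->]; rewrite addr0.
Qed.

End Dual.

Theorem theorem5p8 (F : finFieldType) (L : splittingFieldType F)
    (n h r r0 d : nat) (C : {vspace {ffun 'I_n -> L}}) :
  (0 < h)%N ->
  r = (h + r0)%N -> (1 <= r0)%N -> (r0 < h)%N ->
  additive_qmds_code C r h d -> faithful_code C ->
  exists d' : nat, additive_qmds_code (dual_code C) (n * h - r)%N h d'.
Proof.
move=> h_gt0 rE r0_gt0 ltr0h [[dimL dimC _] _] faithC.
have ltr2 : (r < 2 * h)%N by rewrite rE mul2n -addnn ltn_add2l.
(* Ensures that the subtraction in [n * h - r] is not truncated. *)
have le_rn : (r <= n * h)%N.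
  rewrite -dimC -dimL; apply: leq_trans (dimvS (subvf C)) _.
  by rewrite dimvf /dim /= card_ord -/(dim L) -dimvf.
(* From [h < r <= n * h]; this supplies the two coordinates that carry a light dual word. *)
have n_gt1 : (1 < n)%N.
  rewrite -(ltn_pmul2r h_gt0) mul1n; apply: leq_trans le_rn.
  by rewrite rE -addn1 leq_add2l.
have nij : Ordinal (ltnW n_gt1) != Ordinal n_gt1 by [].
have [v [vC nz_v le_v2]] : exists v,
    [/\ v \in dual_code C, v != 0 & (wt v <= 2)%N].
  by apply: dual_wt_le2 nij _; rewrite dimC dimL.
exists 2%N; split; first split=> //.
- by rewrite dim_dual_code dimL dimC.
- split; last by move=> c; apply: faithful_dual_wt.
  exists v; first by rewrite vC.
  by apply/eqP; rewrite eqn_leq le_v2 (faithful_dual_wt faithC).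
(* As [1 < r / h < 2], the number [n - r / h] lies between [n - 2] and [n - 1]; its ceiling [n - 1]
   makes the QMDS distance [n - (n - 1) + 1 = 2]. *)
suff -> : Num.ceil ((n * h - r)%:R / h%:R : rat) = n%:Z - 1.
  by rewrite opprB addrCA subrr.
have h_gt0' : 0 < h%:R :> rat by rewrite ltr0n.
apply: ceil_def; rewrite ltr_pdivlMr // ler_pdivrMr // natrB // natrM.
rewrite -addrA -[- 1 - 1]opprD !intrB !mulrBl -!pmulrn lerD2l ltrD2l.
rewrite lerN2 ltrN2 mul1r ler_nat rE leq_addr /=.
by rewrite andbT -rE -natrM ltr_nat.
Qed.
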